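(* Let $P=(V,\prec)$ be a bipartite poset. Let $K$ be the set of height-1 elements of $P$ and $S$ the set of height-0 elements. Let $G$ be the graph on $V$ whose edges are the pairs $uv$ with $u\prec v$ in $P$ together with all pairs of distinct elements of $K$. Then $G$ is a split graph, and $G$ is an unbalanced split graph if and only if $P$ is unbalanced (equivalently, $G$ is balanced if and only if $P$ is balanced).
   Context: A bipartite poset is a finite poset of height at most one (no $x\prec y\prec z$). An element $v$ has height 1 if there is $u$ with $u\prec v$, and height 0 otherwise. A height-0 element is a full support point if it is comparable to every height-1 element. A bipartite poset is unbalanced if it contains a full support point and balanced otherwise. A finite graph $G$ is a split graph if its vertex set can be partitioned as $K\cup S$ with $K$ a clique and $S$ a stable set (a $KS$-partition); it is balanced if it has a $KS$-partition with $|K|=\omega(G)$ (clique number) and $|S|=\alpha(G)$ (independence number), and unbalanced otherwise. *)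

(* Defs.v *)
From HB Require Import structures.
From mathcomp Require Import all_boot all_order.

Set Implicit Arguments.
Unset Strict Implicit.
Unset Printing Implicit Defensive.

Import Order.TTheory.
Local Open Scope order_scope.

Record sgraph (V : finType) := SGraph {
  adj :> rel V;
  adj_sym : symmetric adj;
  adj_irr : irreflexive adj
}.

Section SplitGraphs.
Variables (V : finType) (G : sgraph V).
Implicit Types A K S : {set V}.

Definition clique A : bool :=
  [forall x in A, forall y in A, (x != y) ==> G x y].

Definition stable A : bool :=
  [forall x in A, forall y in A, ~~ G x y].

Definition clique_number : nat := (\max_(A : {set V} | clique A) #|A|)%N.

Definition independence_number : nat :=
  (\max_(A : {set V} | stable A) #|A|)%N.

(* Either part may be empty. *)
Definition KS_partition K S : Prop :=
  [/\ K :|: S = [set: V], [disjoint K & S], clique K & stable S].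

Definition split_graph : Prop := exists K S, KS_partition K S.

Definition balanced_split_graph : Prop :=
  exists K S, [/\ KS_partition K S,
                  #|K| = clique_number & #|S| = independence_number].

Definition unbalanced_split_graph : Prop :=
  split_graph /\ ~ balanced_split_graph.

End SplitGraphs.

Section BipartitePosets.
Variables (disp : Order.disp_t) (V : finPOrderType disp).
Implicit Types u v w x y : V.

Definition bipartite_poset : Prop := forall x y z : V, ~ (x < y /\ y < z).

Definition height1 v : bool := [exists u : V, u < v].
Definition height0 v : bool := ~~ height1 v.

Definition full_support_point v : Prop :=
  height0 v /\ forall w, height1 w -> v >=< w.

Definition unbalanced_poset : Prop := exists v, full_support_point v.
Definition balanced_poset : Prop := ~ unbalanced_poset.

Definition poset_adj : rel V := fun x y =>
  [|| x < y, y < x | [&& height1 x, height1 y & x != y]].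

Lemma poset_adj_sym : symmetric poset_adj.
Proof.
by move=> x y; rewrite /poset_adj orbCA andbCA eq_sym.
Qed.

Lemma poset_adj_irr : irreflexive poset_adj.
Proof. by move=> x; rewrite /poset_adj ltxx eqxx !andbF. Qed.

Definition poset_graph : sgraph V := SGraph poset_adj_sym poset_adj_irr.

End BipartitePosets.

Arguments bipartite_poset {disp} V.
Arguments unbalanced_poset {disp} V.
Arguments balanced_poset {disp} V.
Arguments poset_graph {disp} V.

(* Main.v *)
(* Write K, S for the height-1 and height-0 elements.  In any KS-partition, K
   falls short of a maximum clique exactly when some s in S is adjacent to all
   of K: a clique larger than K is s |: K for such an s.  Dually (complement the
   graph), S falls short of a maximum stable set exactly when some k in K has no
   neighbour in S, which cannot happen here because k lies above a height-0
   element.  So S is maximum, and counting vertices shows that the graph is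
   balanced iff K is a maximum clique, that is, iff no s in S is adjacent to all
   of K, i.e. is a full support point. *)
Require Import Defs.
From HB Require Import structures.
From mathcomp Require Import all_boot all_order.

Set Implicit Arguments.
Unset Strict Implicit.
Unset Printing Implicit Defensive.

Import Order.TTheory.

Section SplitGraphTheory.
Variables (V : finType) (G : sgraph V).
Implicit Types A K S : {set V}.

Lemma cliqueP A :
  reflect {in A &, forall x y, x != y -> G x y} (clique G A).
Proof.
apply: (iffP forall_inP) => [cA x y xA yA | cA x xA].
  by move/forall_inP: (cA x xA) => /(_ y yA) /implyP.
by apply/forall_inP => y yA; apply/implyP/cA.
Qed.

Lemma stableP A : reflect {in A &, forall x y, ~~ G x y} (stable G A).
Proof.
apply: (iffP forall_inP) => [sA x y xA yA | sA x xA].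
  by move/forall_inP: (sA x xA) => /(_ y yA).
by apply/forall_inP => y; apply: sA.
Qed.

Lemma cliqueU1 x A :
  x \notin A -> clique G (x |: A) = clique G A && (A \subset G x).
Proof.
move=> xNA; apply/cliqueP/andP => [cxA | [/cliqueP cA /subsetP Gx] y z].
  split; first by apply/cliqueP => y z yA zA; apply: cxA; apply: setU1r.
  apply/subsetP => y yA; apply: cxA; rewrite ?setU11 ?setU1r //.
  by apply: contraNneq xNA => ->.
case/setU1P=> [-> | yA] /setU1P[-> | zA]; last exact: cA.
- by rewrite eqxx.
- by move=> _; apply: Gx.
- by move=> _; rewrite adj_sym; apply: Gx.
Qed.

Lemma card_clique_setI_stable A S :
  clique G A -> stable G S -> #|A :&: S| <= 1.
Proof.
move=> /cliqueP cA /stableP sS.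
apply/card_le1_eqP => x y /setIP[xA xS] /setIP[yA yS].
by apply: contraNeq (sS y x yS xS); apply: cA.
Qed.

Lemma ltn_clique_numberP n :
  reflect (exists2 A, clique G A & n < #|A|) (n < clique_number G).
Proof.
apply: (iffP idP) => [|[A cA /leq_trans]]; last first.
  by apply; apply: (bigop.bigmax_sup A).
rewrite ltnNge => /bigop.bigmax_leqP max_n; apply/exists_inP.
apply: contra_notT max_n => /exists_inPn noA A cA.
by rewrite leqNgt noA.
Qed.

Lemma KS_partition_setC K S : KS_partition G K S -> S = ~: K.
Proof.
case=> KUS dKS _ _; apply/eqP; rewrite eqEsubset -disjoints_subset.
by rewrite disjoint_sym dKS -setTD subDset KUS subxx.
Qed.

Lemma KS_card_clique_numberE K S : KS_partition G K S ->
  (#|K| == clique_number G) = ~~ [exists s in S, K \subset G s].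
Proof.
move=> KS; have [_ _ cK stS] := KS.
rewrite eqn_leq bigop.leq_bigmax_cond // leqNgt; congr (~~ _).
have SE x : (x \in S) = (x \notin K) by rewrite (KS_partition_setC KS) inE.
apply/ltn_clique_numberP/exists_inP => [[A cA KltA] | [s sS Ks]]; last first.
  rewrite SE in sS; exists (s |: K); last by rewrite cardsU1 sS.
  by rewrite cliqueU1 ?cK.
have /subsetPn[s sA sNK] : ~~ (A \subset K).
  by apply: contraL KltA => /subset_leq_card; rewrite -leqNgt.
have sS : s \in S by rewrite SE.
have subAK : A :\ s \subset K.
  apply/subsetP => x /setD1P[xs xA]; apply: contraNT xs; rewrite -SE => xS.
  by apply/eqP/(card_le1_eqP (card_clique_setI_stable cA stS)); apply/setIP.
have AE : A :\ s = K.
  by apply/eqP; rewrite eqEcard subAK; rewrite (cardsD1 s A) sA in KltA.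
exists s => //; move: cA.
by rewrite -(setD1K sA) AE cliqueU1 // => /andP[].
Qed.

Lemma KS_partition_card K S : KS_partition G K S -> #|K| + #|S| = #|V|.
Proof. by move=> /KS_partition_setC ->; rewrite cardsC. Qed.

Lemma KS_balancedP K S : KS_partition G K S -> #|S| = independence_number G ->
  reflect (balanced_split_graph G) (#|K| == clique_number G).
Proof.
move=> KS maxS; apply: (iffP eqP) => [maxK | [K' [S' [KS' maxK' maxS']]]].
  by exists K, S.
apply/eqP; rewrite -(eqn_add2r #|S|) (KS_partition_card KS).
by rewrite -(KS_partition_card KS') maxK' maxS' maxS.
Qed.

End SplitGraphTheory.

Section Complement.
Variables (V : finType) (G : sgraph V).
Implicit Types A K S : {set V}.

Definition compl_adj : rel V := fun x y => (x != y) && ~~ G x y.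

Lemma compl_adj_sym : symmetric compl_adj.
Proof. by move=> x y; rewrite /compl_adj eq_sym adj_sym. Qed.

Lemma compl_adj_irr : irreflexive compl_adj.
Proof. by move=> x; rewrite /compl_adj eqxx. Qed.

Definition sgraph_compl : sgraph V := SGraph compl_adj_sym compl_adj_irr.

Lemma clique_compl A : clique sgraph_compl A = stable G A.
Proof.
apply/cliqueP/stableP => [cA x y xA yA | sA x y xA yA xy].
  by have [-> | /(cA x y xA yA) /andP[]] := eqVneq x y; rewrite ?adj_irr.
by rewrite /= /compl_adj xy sA.
Qed.

Lemma stable_compl A : stable sgraph_compl A = clique G A.
Proof.
apply/stableP/cliqueP => [sA x y xA yA xy | cA x y xA yA].
  by have := sA x y xA yA; rewrite /= /compl_adj xy negbK.
by rewrite /= /compl_adj negb_and negbK -implyNb negbK; apply/implyP/cA.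
Qed.

Lemma clique_number_compl : clique_number sgraph_compl = independence_number G.
Proof. by apply: eq_bigl => A; rewrite clique_compl. Qed.

Lemma KS_partition_compl K S :
  KS_partition G K S -> KS_partition sgraph_compl S K.
Proof.
case=> KUS dKS cK sS.
by split; rewrite 1?setUC 1?disjoint_sym ?clique_compl ?stable_compl.
Qed.

Lemma KS_card_independence_numberE K S : KS_partition G K S ->
  (#|S| == independence_number G) = ~~ [exists k in K, [disjoint S & G k]].
Proof.
move=> KS; rewrite -clique_number_compl.
rewrite (KS_card_clique_numberE (KS_partition_compl KS)); congr (~~ _).
apply: eq_existsb_in => k kK; rewrite disjoint_subset.
apply/subsetP/subsetP => Sk s sS; have := Sk s sS; first by case/andP.
rewrite inE => Gks; apply/andP; split=> //.
by apply: contraTneq sS => <-; rewrite (KS_partition_setC KS) inE kK.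
Qed.

End Complement.

Section PosetGraph.
Variables (disp : Order.disp_t) (V : finPOrderType disp).
Implicit Types u v w : V.

Let K := [set v : V | height1 v].
Let S := [set v : V | height0 v].

Lemma height0_not_gt u v : height0 v -> (u < v)%O = false.
Proof. by move=> /existsPn/(_ u)/negbTE. Qed.

Lemma poset_adj_height01 v w :
  height0 v -> height1 w -> poset_adj v w = (v >=< w)%O.
Proof.
move=> v0 w1; have /negbTE vw : v != w by apply: contraNneq v0 => ->.
rewrite /poset_adj (negbTE v0) orbF.
by rewrite /Order.comparable !le_eqVlt [w == v]eq_sym vw.
Qed.

Lemma unbalanced_posetP :
  reflect (unbalanced_poset V) [exists v in S, K \subset poset_graph V v].
Proof.
apply: (iffP exists_inP) => [[v] | [v [v0 full_v]]].
  rewrite inE => v0 /subsetP full_v; exists v; split=> // w w1.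
  by rewrite -poset_adj_height01 //; apply: full_v; rewrite inE.
exists v; first by rewrite inE.
apply/subsetP => w; rewrite inE => w1.
by move: (full_v w w1); rewrite -poset_adj_height01.
Qed.

Lemma poset_graph_KS_partition : KS_partition (poset_graph V) K S.
Proof.
have SE : S = ~: K by apply/setP => v; rewrite !inE.
split; first by rewrite SE setUCr.
- by rewrite SE -setI_eq0 setICr.
- apply/cliqueP => v w; rewrite !inE /= /poset_adj => -> -> ->.
  by rewrite !orbT.
- apply/stableP => v w; rewrite !inE /= /poset_adj => v0 w0.
  by rewrite !height0_not_gt // (negbTE v0).
Qed.

Hypothesis bipV : bipartite_poset V.

Lemma height0_lt u v : (u < v)%O -> height0 u.
Proof.
move=> uv; apply/existsPn => t; apply/negP => tu.
exact: (bipV (conj tu uv)).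
Qed.

Lemma poset_graph_independence_number :
  #|S| = independence_number (poset_graph V).
Proof.
apply/eqP; rewrite (KS_card_independence_numberE poset_graph_KS_partition).
apply/exists_inPn => k; rewrite inE => /existsP[s sk].
apply/pred0Pn; exists s; apply/andP; split.
  by rewrite /= inE (height0_lt sk).
exact/or3P/Or32.
Qed.

Lemma poset_graph_balancedP :
  reflect (balanced_split_graph (poset_graph V))
          (~~ [exists v in S, K \subset poset_graph V v]).
Proof.
rewrite -(KS_card_clique_numberE poset_graph_KS_partition).
exact: KS_balancedP poset_graph_KS_partition poset_graph_independence_number.
Qed.

End PosetGraph.

Theorem theorem4p3 (disp : Order.disp_t) (V : finPOrderType disp)
    (bipV : bipartite_poset V) :
  [/\ split_graph (poset_graph V),
      unbalanced_split_graph (poset_graph V) <-> unbalanced_poset V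
    & balanced_split_graph (poset_graph V) <-> balanced_poset V].
Proof.
have splitV : split_graph (poset_graph V).
  by do 2!eexists; apply: poset_graph_KS_partition.
have balP := poset_graph_balancedP bipV; have unbalP := unbalanced_posetP V.
split=> //; split.
- by case=> _ /balP/unbalP.
- by move=> /unbalP unbV; split=> // /balP/negP.
- by move=> /balP/negP + /unbalP.
- by move=> balV; apply/balP/negP => /unbalP.
Qed.
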